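(* Let $c\in\mathbb{C}$ and $r_0\ge0$, and suppose that $\overline{B}(c,r_0)=\{c'\in\mathbb{C}:|c'-c|\le r_0\}$ contains a superattracting parameter $\tilde c$. If there exist $N\in\mathbb{N}$ and $c_1,\dots,c_N\in\overline{B}(c,r_0)$ such that $f_{c_N}\circ\cdots\circ f_{c_1}$ has a parabolic periodic point, then $r_{\mathrm{bif}}(c)\le r_0$.
   Context: $f_c(z)=z^2+c$, extended to $\widehat{\mathbb{C}}$ by $f_c(\infty)=\infty$. A parameter $\tilde c$ is superattracting if $f_{\tilde c}^{\circ p}(0)=0$ for some $p\in\mathbb{N}$. A parabolic periodic point of a polynomial $g$ is a periodic point $z^*$ (with $g^{\circ q}(z^* )=z^*$) whose multiplier $(g^{\circ q})'(z^* )$ is a root of unity. For $c\in\mathbb{C}$, $r\ge0$, $G_{c,r}$ is the semigroup under composition generated by $\{f_{c'}:|c'-c|\le r\}$. A minimal set of a polynomial semigroup $G$ is a minimal element, with respect to inclusion, of the family of non-empty compact $L\subset\widehat{\mathbb{C}}$ with $g(L)\subset L$ for all $g\in G$; it is planar if $\infty\notin L$. The bifurcation radius $r_{\mathrm{bif}}(c)$ is the supremum of those $r\ge0$ for which $G_{c,r}$ has a planar minimal set (equivalently the infimum of those $r\ge0$ for which $G_{c,r}$ has no planar minimal set); by prior work this value is attained and $G_{c,r}$ has a planar minimal set iff $r\le r_{\mathrm{bif}}(c)$. *)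

(* Defs.v *)
From HB Require Import structures.
From mathcomp Require Import all_boot all_order all_algebra.
From mathcomp Require Import complex.
From mathcomp Require Import all_classical all_reals ereal topology normedtype.
From mathcomp Require Import one_point_compactification.
Import numFieldNormedType.Exports.
Import Order.TTheory GRing.Theory Num.Theory.

Set Implicit Arguments.
Unset Strict Implicit.
Unset Printing Implicit Defensive.

Local Open Scope ring_scope.
Local Open Scope classical_set_scope.
Local Open Scope complex_scope.

(* The complex numbers R[i], with the norm (modulus) topology. *)
Definition Cx (R : realType) : numClosedFieldType := R[i].

(* The Riemann sphere: one-point compactification of C; None = infinity. *)
Definition Chat (R : realType) : topologicalType :=
  one_point_compactification (Cx R).

Section defs.
Variable R : realType.

Definition fpoly (c : Cx R) : {poly Cx R} := 'X^2 + c%:P.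

Definition fhat (c : Cx R) (z : Chat R) : Chat R :=
  match z with Some w => Some (w ^+ 2 + c) | None => None end.

Definition cball (c : Cx R) (r : R) : set (Cx R) :=
  [set c' | `|c' - c| <= r%:C].

(* f_{c_N} o ... o f_{c_1} on the sphere, for s = [:: c_1; ...; c_N] *)
Definition fhat_comp (s : seq (Cx R)) : Chat R -> Chat R :=
  foldl (fun g c => fhat c \o g) id s.

Definition fpoly_comp (s : seq (Cx R)) : {poly Cx R} :=
  foldl (fun P c => fpoly c \Po P) 'X s.

Definition Gsemi (c : Cx R) (r : R) : set (Chat R -> Chat R) :=
  [set g | exists s : seq (Cx R),
     (0 < size s)%N /\ (forall c', c' \in s -> cball c r c') /\ g = fhat_comp s].

Definition invariant_compact (G : set (Chat R -> Chat R)) (L : set (Chat R)) :=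
  L !=set0 /\ compact L /\ (forall g, G g -> g @` L `<=` L).

Definition minimal_set (G : set (Chat R -> Chat R)) (L : set (Chat R)) :=
  invariant_compact G L /\
  (forall L', invariant_compact G L' -> L' `<=` L -> L' = L).

Definition planar (L : set (Chat R)) : Prop := ~ L None.

Definition has_planar_minimal_set (G : set (Chat R -> Chat R)) : Prop :=
  exists L, minimal_set G L /\ planar L.

Definition r_bif (c : Cx R) : \bar R :=
  ereal_sup [set r%:E | r in [set r : R | 0 <= r /\ has_planar_minimal_set (Gsemi c r)]].

Definition superattracting (ct : Cx R) : Prop :=
  exists p : nat, (0 < p)%N /\ iter p (fun z : Cx R => z ^+ 2 + ct) 0 = 0.

Definition poly_iter (g : {poly Cx R}) (q : nat) : {poly Cx R} :=
  iter q (fun P => g \Po P) 'X.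

Definition root_of_unity (m : Cx R) : Prop :=
  exists n : nat, (0 < n)%N /\ m ^+ n = 1.

Definition parabolic_periodic_point (g : {poly Cx R}) (z : Cx R) : Prop :=
  exists q : nat, (0 < q)%N /\ (poly_iter g q).[z] = z /\
    root_of_unity ((poly_iter g q)^`()).[z].

End defs.

(* Main.v *)
Require Import Defs.
From HB Require Import structures.
From mathcomp Require Import all_boot all_order all_algebra.
From mathcomp Require Import complex.
From mathcomp Require Import all_classical all_reals ereal topology normedtype.
From mathcomp Require Import one_point_compactification ring lra.
Import numFieldNormedType.Exports.
Import Order.TTheory GRing.Theory Num.Theory.

Set Implicit Arguments.
Unset Strict Implicit.
Unset Printing Implicit Defensive.

Local Open Scope ring_scope.
Local Open Scope classical_set_scope.

(** If [r > r0] and [L] is a planar minimal set of [G_{c,r}], put [d = r - r0]: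
    every [f_{c'}] with [|c' - c| <= r0] maps [L] into the set of points whose
    [d]-neighbourhood lies in [L]. Hence replacing [f] by [f + e (f - f z)] along
    the orbit of [z] (the Earle-Hamilton trick) still maps [L] into itself, and
    multipliers of words of length [n] at inner points of [L] are
    [O((1 + e)^-n)]. If [0] were not in [L], the inverse branches of the iterates
    of the superattracting map would be defined on discs of fixed size around
    points of [L], which bounds the multipliers from below: contradiction. So
    [0 \in L], and all critical values of words lie well inside [L]. A parabolic
    point in [L] contradicts the upper bound. A parabolic point outside [L] has
    inverse branches of all the words on a fixed disc, avoiding [L]; by the same
    trick applied to inverse branches, the multipliers grow like [(1 + e)^n],
    again a contradiction. *)

(** * Modulus, continuity and polynomials *)

Section modulus.
Variable R : realType.
Local Notation C := (Cx R).
Implicit Types (x y z w : C) (D : set C).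

(* The modulus as a real number; the library norm of [Cx R] is [Cx R]-valued. *)
Definition nm (z : C) : R := Normc.normc z.

Definition rc (t : R) : C := (t%:C)%C.

Lemma norm_nm z : `|z| = rc (nm z). Proof. by []. Qed.

Lemma rc_le s t : (rc s <= rc t) = (s <= t). Proof. exact: lecR. Qed.
Lemma rc_lt s t : (rc s < rc t) = (s < t). Proof. exact: ltcR. Qed.
Lemma rcD s t : rc (s + t) = rc s + rc t. Proof. exact: rmorphD. Qed.
Lemma rcN t : rc (- t) = - rc t. Proof. exact: rmorphN. Qed.
Lemma rcM s t : rc (s * t) = rc s * rc t. Proof. exact: rmorphM. Qed.
Lemma rc1 : rc 1 = 1. Proof. exact: rmorph1. Qed.
Lemma rc_nat n : rc n%:R = n%:R. Proof. exact: rmorph_nat. Qed.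
Lemma rc0 : rc 0 = 0. Proof. exact: rmorph0. Qed.

Lemma nm_ge0 z : 0 <= nm z.
Proof. by rewrite -rc_le rc0 -norm_nm normr_ge0. Qed.
Lemma nm0 : nm 0 = 0. Proof. exact: Normc.normc0. Qed.
Lemma nm1 : nm 1 = 1. Proof. exact: Normc.normc1. Qed.
Lemma nm0_eq0 z : nm z = 0 -> z = 0. Proof. exact: Normc.eq0_normc. Qed.
Lemma nmM x y : nm (x * y) = nm x * nm y. Proof. exact: Normc.normcM. Qed.
Lemma nmV x : nm x^-1 = (nm x)^-1. Proof. exact: Normc.normcV. Qed.
Lemma nmN x : nm (- x) = nm x. Proof. exact: (@normcN R x). Qed.
Lemma nmD x y : nm (x + y) <= nm x + nm y. Proof. exact: (@le_normcD R x y). Qed.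
Lemma nmB x y : nm (x - y) = nm (y - x). Proof. by rewrite -nmN opprB. Qed.
Lemma nm_rc t : nm (rc t) = `|t|.
Proof. by rewrite /nm /= expr0n /= addr0 sqrtr_sqr. Qed.
Lemma nmX x n : nm (x ^+ n) = nm x ^+ n.
Proof. by elim: n => [|n IH]; rewrite ?expr0 ?nm1 // !exprS nmM IH. Qed.

Lemma nm_gt0 z : (0 < nm z) = (z != 0).
Proof.
rewrite lt_def nm_ge0 andbT; congr negb.
by apply/eqP/eqP => [/nm0_eq0 //|->]; exact: nm0.
Qed.

Lemma nmD_ge x y : nm x - nm y <= nm (x + y).
Proof. by have := nmD (x + y) (- y); rewrite addrK nmN; lra. Qed.

(** Epsilon-delta continuity relative to [D], in the real modulus. The relative form matters: square
    roots and inverse branches are controlled only on a half-plane or a square. *)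
Definition cont_on D (f : C -> C) := forall x, D x -> forall e : R, 0 < e ->
  exists2 d : R, 0 < d & forall y, D y -> nm (y - x) < d -> nm (f y - f x) < e.

Lemma cont_on_cst D (a : C) : cont_on D (fun=> a).
Proof. by move=> x _ e e0; exists 1 => // y _ _; rewrite subrr nm0. Qed.

Lemma cont_on_id D : cont_on D id.
Proof. by move=> x _ e e0; exists e. Qed.

Lemma cont_onD D f g : cont_on D f -> cont_on D g -> cont_on D (fun z => f z + g z).
Proof.
move=> cf cg x Dx e e0.
have [|d1 d10 h1] := cf x Dx (e / 2); first by lra.
have [|d2 d20 h2] := cg x Dx (e / 2); first by lra.
exists (Num.min d1 d2); first by rewrite lt_min d10.
move=> y Dy; rewrite lt_min => /andP[/(h1 _ Dy) l1 /(h2 _ Dy) l2].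
have -> : f y + g y - (f x + g x) = (f y - f x) + (g y - g x) by ring.
by have := nmD (f y - f x) (g y - g x); lra.
Qed.

Lemma cont_onM D f g : cont_on D f -> cont_on D g -> cont_on D (fun z => f z * g z).
Proof.
move=> cf cg x Dx e e0.
set A := nm (f x); set B := nm (g x).
have A0 : 0 <= A := nm_ge0 _; have B0 : 0 <= B := nm_ge0 _.
pose t := Num.min 1 (e / (A + B + 1)).
have AB : 0 < A + B + 1 by lra.
have t0 : 0 < t by rewrite lt_min ltr01 divr_gt0.
have t1 : t <= 1 by rewrite ge_min lexx.
have te : t * (A + B + 1) <= e by rewrite -ler_pdivlMr // ge_min lexx orbT.
have [d1 d10 h1] := cf x Dx t t0.
have [d2 d20 h2] := cg x Dx t t0.
exists (Num.min d1 d2); first by rewrite lt_min d10.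
move=> y Dy; rewrite lt_min => /andP[/(h1 _ Dy) l1 /(h2 _ Dy) l2].
have -> : f y * g y - f x * g x =
  (f y - f x) * (g y - g x) + (f y - f x) * g x + f x * (g y - g x) by ring.
have := nmD ((f y - f x) * (g y - g x) + (f y - f x) * g x) (f x * (g y - g x)).
have := nmD ((f y - f x) * (g y - g x)) ((f y - f x) * g x).
rewrite !nmM -/A -/B.
have := nm_ge0 (f y - f x); have := nm_ge0 (g y - g x).
move: (nm (f y - f x)) (nm (g y - g x)) l1 l2 => u v ut vt v0 u0.
have : u * v <= t * v by rewrite ler_wpM2r // ltW.
have : t * v <= 1 * v by rewrite ler_wpM2r.
have : u * B <= t * B by rewrite ler_wpM2r // ltW.
have : A * v <= A * t by rewrite ler_wpM2l // ltW.
lra.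
Qed.

Lemma cont_on_comp D E f g : (forall x, D x -> E (f x)) ->
  cont_on D f -> cont_on E g -> cont_on D (fun z => g (f z)).
Proof.
move=> DE cf cg x Dx e e0; have [d1 d10 h1] := cg (f x) (DE _ Dx) e e0.
have [d2 d20 h2] := cf x Dx d1 d10.
by exists d2 => // y Dy yx; apply: h1; [exact: DE|exact: h2].
Qed.

Lemma cont_onV D f : (forall x, D x -> f x != 0) ->
  cont_on D f -> cont_on D (fun z => (f z)^-1).
Proof.
move=> f0 cf x Dx e e0; set A := nm (f x).
have A0 : 0 < A by rewrite nm_gt0 f0.
pose t := Num.min (A / 2) (e * (A ^+ 2 / 2)).
have t0 : 0 < t by rewrite lt_min divr_gt0 //= mulr_gt0 // divr_gt0 // exprn_gt0.
have [d d0 h] := cf x Dx t t0.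
exists d => // y Dy yx; have := h _ Dy yx.
rewrite lt_min => /andP[l1 l2].
have -> : (f y)^-1 - (f x)^-1 = - ((f y - f x) / (f y * f x)).
  by field; rewrite !f0.
have l3 : A / 2 <= nm (f y).
  by have := nmD_ge (f x) (f y - f x); rewrite [f x + _]addrC subrK -/A; lra.
rewrite nmN nmM nmV nmM -/A ltr_pdivrMr; last by rewrite mulr_gt0 //; lra.
apply: lt_le_trans l2 _; rewrite ler_pM2l // expr2.
have : A / 2 * A <= nm (f y) * A by rewrite ler_pM2r.
lra.
Qed.

Lemma eq_cont_on D f g : (forall x, D x -> f x = g x) -> cont_on D f -> cont_on D g.
Proof.
move=> fg cf x Dx e e0; have [d d0 h] := cf x Dx e e0.
by exists d => // y Dy yx; rewrite -!fg //; exact: h.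
Qed.

Lemma cont_on_poly D (p : {poly C}) : cont_on D (fun z => p.[z]).
Proof.
elim/poly_ind: p => [|p c IH].
  by apply: eq_cont_on (cont_on_cst 0) => z _; rewrite horner0.
apply: eq_cont_on (cont_onD (cont_onM IH (@cont_on_id D)) (cont_on_cst c)).
by move=> z _; rewrite hornerMXaddC.
Qed.

(* With [p - p.[a] = q ('X - a)^m] and [q.[a] != 0], move from [a] in the
   direction of an [m]-th root of [s p.[a] / q.[a]]. *)
Lemma poly_local_direction (p : {poly C}) (a s : C) (eta : R) :
  (1 < size p)%N -> 0 < eta ->
  exists z, exists t : R, exists k : C, [/\ nm (z - a) < eta, 0 < t <= 1,
    nm (k - 1) <= 1 / 2 & p.[z] = p.[a] * (1 + s * rc t * k)].
Proof.
move=> sp eta0.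
have [m [q]] := multiplicity_XsubC (p - (p.[a])%:P) a.
have -> /= : p - (p.[a])%:P != 0.
  rewrite subr_eq0; apply: contraTneq sp => ->.
  by rewrite -leqNgt size_polyC leq_b1.
rewrite /root => qa0 pq.
have hp z : p.[z] = p.[a] + q.[z] * (z - a) ^+ m.
  have : (p - (p.[a])%:P).[z] = q.[z] * (z - a) ^+ m.
    by rewrite {1}pq hornerM horner_exp hornerXsubC.
  by rewrite hornerD hornerN hornerC => <-; rewrite addrC subrK.
have m0 : (0 < m)%N.
  case: m {pq} hp => // hp; have := hp a; rewrite expr0 mulr1 -[X in X = _]addr0.
  by move/addrI => /esym/eqP; rewrite (negbTE qa0).
pose u := m.-root (s * p.[a] / q.[a]).
have um : u ^+ m = s * p.[a] / q.[a] by rewrite rootCK.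
have [|d d0 hd] := cont_on_poly q (D := setT) (x := a) I (e := nm q.[a] / 2).
  by rewrite divr_gt0 // nm_gt0.
pose mu := Num.min eta d; have mu0 : 0 < mu by rewrite lt_min eta0.
have U0 := nm_ge0 u.
pose tau := Num.min 1 (mu / (nm u + 1)).
have tau0 : 0 < tau by rewrite lt_min ltr01 divr_gt0 //; lra.
have tau1 : tau <= 1 by rewrite ge_min lexx.
have taumu : tau * nm u < mu.
  have : tau * (nm u + 1) <= mu.
    by rewrite -ler_pdivlMr ?ge_min ?lexx ?orbT //; lra.
  by rewrite mulrDr; lra.
have nz : nm (a + rc tau * u - a) < mu.
  by rewrite addrC addKr nmM nm_rc gtr0_norm.
exists (a + rc tau * u), (tau ^+ m), (q.[a + rc tau * u] / q.[a]); split.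
- by apply: lt_le_trans nz _; rewrite ge_min lexx.
- by rewrite exprn_gt0 //= exprn_ile1 // ltW.
- have -> : q.[a + rc tau * u] / q.[a] - 1 = (q.[a + rc tau * u] - q.[a]) / q.[a].
    by field.
  rewrite nmM nmV ler_pdivrMr ?nm_gt0 //.
  have nzd : nm (a + rc tau * u - a) < d.
    by apply: lt_le_trans nz _; rewrite ge_min lexx orbT.
  by have := hd _ I nzd; lra.
- rewrite hp [a + _ - a]addrC addKr exprMn um; have -> : rc (tau ^+ m) = rc tau ^+ m.
    by elim: (m) => [|n IH]; rewrite ?expr0 ?rc1 // !exprS rcM IH.
  by field.
Qed.

(** With [s = -1] the value is multiplied by [(1 - t) + t (1 - k)], of modulus at most [1 - t / 2].
    The maximum principle below takes [s = 1] and gets a factor of modulus at least [1 + t / 2]. *)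
Lemma poly_no_local_min (p : {poly C}) a (eta : R) :
  (1 < size p)%N -> p.[a] != 0 -> 0 < eta ->
  exists2 z, nm (z - a) < eta & nm p.[z] < nm p.[a].
Proof.
move=> sp pa0 eta0; have [z [t [k [za /andP[t0 t1] k1 pz]]]] :=
  poly_local_direction a (-1) sp eta0.
exists z => //; rewrite pz nmM gtr_pMr ?nm_gt0 //.
have -> : 1 + -1 * rc t * k = rc (1 - t) + rc t * (1 - k).
  by rewrite rcD -rc1 rcN; ring.
have := nmD (rc (1 - t)) (rc t * (1 - k)).
rewrite nmM !nm_rc (nmB 1) (gtr0_norm t0) ger0_norm; last by lra.
have : t * nm (k - 1) <= t * (1 / 2) by rewrite ler_pM2l.
lra.
Qed.

Lemma poly_no_local_max (p : {poly C}) a (eta : R) :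
  (1 < size p)%N -> p.[a] != 0 -> 0 < eta ->
  exists2 z, nm (z - a) < eta & nm p.[a] < nm p.[z].
Proof.
move=> sp pa0 eta0; have [z [t [k [za /andP[t0 t1] k1 pz]]]] :=
  poly_local_direction a 1 sp eta0.
exists z => //; rewrite pz nmM ltr_pMr ?nm_gt0 //.
have -> : 1 + 1 * rc t * k = rc (1 + t) + rc t * (k - 1).
  by rewrite rcD -rc1; ring.
have := nmD_ge (rc (1 + t)) (rc t * (k - 1)).
rewrite nmM !nm_rc (gtr0_norm t0) ger0_norm; last by lra.
have : t * nm (k - 1) <= t * (1 / 2) by rewrite ler_pM2l.
lra.
Qed.

End modulus.

(** * Squares in the complex plane and square roots *)

Section square.
Variable R : realType.
Local Notation C := (Cx R).
Local Notation Re := (@complex.Re R).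
Local Notation Im := (@complex.Im R).
Implicit Types (x y z w : C) (rho : R).

Lemma nm_Re z : `|Re z| <= nm z.
Proof.
case: z => a b; rewrite /nm /= -sqrtr_sqr ler_wsqrtr //.
by rewrite lerDl sqr_ge0.
Qed.

Lemma nm_Im z : `|Im z| <= nm z.
Proof.
case: z => a b; rewrite /nm /= -sqrtr_sqr ler_wsqrtr //.
by rewrite lerDr sqr_ge0.
Qed.

Lemma nm_le_ReIm z : nm z <= `|Re z| + `|Im z|.
Proof.
rewrite -[X in _ <= X]ger0_norm ?addr_ge0 // -sqrtr_sqr.
case: z => a b; rewrite /nm /= ler_wsqrtr // sqrrD !real_normK ?num_real //.
by rewrite -addrA lerD2l lerDr mulrn_wge0 // mulr_ge0.
Qed.

Lemma ReD x y : Re (x + y) = Re x + Re y. Proof. by case: x y => [? ?] []. Qed.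
Lemma ReN x : Re (- x) = - Re x. Proof. by case: x. Qed.
Lemma Re_rcM (t : R) x : Re (rc t * x) = t * Re x.
Proof. by case: x => a b /=; rewrite mul0r subr0. Qed.
Lemma Im_rcM (t : R) x : Im (rc t * x) = t * Im x.
Proof. by case: x => a b /=; rewrite mul0r addr0. Qed.

(** Squares replace discs because they are products of two segments, hence compact, and are
    star-shaped about [w0]. They lie between the discs of radii [rho] and [2 * rho]. *)
Definition square w0 rho : set C :=
  [set w | `|Re (w - w0)| <= rho /\ `|Im (w - w0)| <= rho].

Lemma square_center w0 rho : 0 <= rho -> square w0 rho w0.
Proof. by move=> ?; rewrite /square /= subrr !normr0. Qed.

Lemma square_nm w0 rho w : square w0 rho w -> nm (w - w0) <= 2 * rho.
Proof. by move=> [h1 h2]; have := nm_le_ReIm (w - w0); lra. Qed.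

Lemma square_interior w0 rho w : square w0 rho w -> nm (w - w0) < rho ->
  exists2 eta : R, 0 < eta & forall y, nm (y - w) < eta -> square w0 rho y.
Proof.
move=> sw wr; exists (rho - nm (w - w0)); first by lra.
move=> y yw; have : nm (y - w0) <= rho.
  by have := nmD (y - w) (w - w0); rewrite addrA subrK; lra.
by move=> yr; split; apply: le_trans yr; rewrite ?nm_Re ?nm_Im.
Qed.

Lemma square_scale w0 rho w (t : R) : 0 <= t <= 1 -> square w0 rho w ->
  square w0 rho (w0 + rc t * (w - w0)).
Proof.
move=> /andP[t0 t1] [h1 h2]; rewrite /square /= addrC addKr Re_rcM Im_rcM.
by rewrite !normrM (ger0_norm t0); split; [move: h1|move: h2];
  apply: le_trans; rewrite ler_piMl.
Qed.

(** Compactness of the square, transported from a product of real segments: what holds eventually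
    near each point holds eventually on the whole square. *)
Lemma square_near_covering w0 rho (I : Type) (F : set_system I) {FF : Filter F}
    (P : I -> C -> Prop) :
  (forall x, square w0 rho x -> exists2 eta : R, 0 < eta &
     \forall i \near F, forall y, nm (y - x) < eta -> P i y) ->
  \forall i \near F, forall x, square w0 rho x -> P i x.
Proof.
move=> cov; pose j (u : R * R) : C := w0 + Complex u.1 u.2.
have : compact (`[- rho, rho]%classic `*` `[- rho, rho]%classic : set (R * R)).
  by apply: compact_setX; exact: segment_compact.
move/compact_near_coveringP => /(_ I F (fun i u => P i (j u)) FF) nc.
apply: (filterS _ (nc _)).
  move=> i Pi x [h1 h2].
  have -> : x = j (Re (x - w0), Im (x - w0)).
    have ec z : Complex (Re z) (Im z) = z by case: z.
    by rewrite /j /= ec addrC subrK.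
  by apply: Pi; split => /=; rewrite in_itv /= -ler_norml.
move=> u [u1 u2]; have [|eta eta0 h] := cov (j u).
  rewrite /square /j /= addrC addKr /=.
  by move: u1 u2; rewrite /= !in_itv /= -!ler_norml.
exists (ball u (eta / 2), [set i | forall y, nm (y - j u) < eta -> P i y]).
  by split => //=; apply: nbhsx_ballx; lra.
move=> [v i] [/= [b1 b2] Pi]; apply: Pi; rewrite /j.
have -> : w0 + Complex v.1 v.2 - (w0 + Complex u.1 u.2) =
  Complex (v.1 - u.1) (v.2 - u.2) by rewrite opprD addrACA subrr add0r.
have := nm_le_ReIm (Complex (v.1 - u.1) (v.2 - u.2)) => /=.
move: b1 b2; rewrite /ball /= distrC (distrC u.2); lra.
Qed.

Lemma near_inv_lt (e : R) : 0 < e -> \forall n \near \oo, (n.+1%:R^-1 : R) < e.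
Proof. by move=> e0; exact: (near_infty_natSinv_lt (PosNum e0)). Qed.

(** Lower semicontinuity makes [f] locally bounded below, and compactness makes the bound global. If
    the infimum [m] were not attained, [f] would exceed [m] by a locally, hence globally, uniform
    gap. Applied to [nm g] and [- nm g] this gives both extrema. *)
Lemma square_lsc_min w0 rho (f : C -> R) : 0 <= rho ->
  (forall x, square w0 rho x -> forall e : R, 0 < e -> exists2 d : R, 0 < d &
     forall y, square w0 rho y -> nm (y - x) < d -> f x - e < f y) ->
  exists2 w1, square w0 rho w1 & forall w, square w0 rho w -> f w1 <= f w.
Proof.
move=> rho0 fc; set D := square w0 rho.
have D0 : D w0 by exact: square_center.
have [b fb] : exists b, forall w, D w -> b <= f w.
  have : \forall n \near \oo, forall x, D x -> D x -> - n%:R <= f x.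
    apply: square_near_covering => x Dx; have [d d0 h] := fc x Dx 1 ltr01.
    exists d => //; near=> n => y yx Dy; apply: ltW.
    apply: le_lt_trans (h y Dy yx); rewrite lerNl opprB.
    by near: n; exact: nbhs_infty_ger.
  by move=> [n _ /(_ n (leqnn n)) h]; exists (- n%:R) => w Dw; exact: h.
pose m := inf (f @` D).
have hi : has_inf (f @` D).
  by split; [exists (f w0), w0|exists b => _ [w Dw <-]; exact: fb].
have mf w : D w -> m <= f w by move=> Dw; apply: ge_inf; [exact: hi.2|exists w].
apply: contrapT => nomin.
have : \forall n \near \oo, forall x, D x -> D x -> m + n.+1%:R^-1 <= f x.
  apply: square_near_covering => x Dx.
  have mx : m < f x.
    rewrite lt_neqAle mf // andbT; apply/eqP => mfx; apply: nomin.
    by exists x => // w Dw; rewrite -mfx mf.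
  have [|d d0 h] := fc x Dx ((f x - m) / 2); first by lra.
  exists d => //; near=> n => y yx Dy; have := h y Dy yx.
  have : (n.+1%:R^-1 : R) < (f x - m) / 2 by near: n; apply: near_inv_lt; lra.
  by set k := n.+1%:R^-1; lra.
move=> [n _ /(_ n (leqnn n)) h].
have n0 : 0 < (n.+1%:R^-1 : R) by rewrite invr_gt0.
have [_ [w Dw <-]] := inf_adherent n0 hi.
by have := h w Dw Dw; rewrite -/m; set k := n.+1%:R^-1; lra.
Unshelve. all: by end_near. Qed.

Lemma square_min w0 rho g : 0 <= rho -> cont_on (square w0 rho) g ->
  exists2 w1, square w0 rho w1 & forall w, square w0 rho w -> nm (g w1) <= nm (g w).
Proof.
move=> rho0 cg; apply: (square_lsc_min (f := fun w => nm (g w))) => // x Dx e e0.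
have [d d0 h] := cg x Dx e e0; exists d => // y Dy yx; have := h y Dy yx.
by have := nmD_ge (g x) (g y - g x); rewrite [g x + _]addrC subrK; lra.
Qed.

Lemma square_max w0 rho g : 0 <= rho -> cont_on (square w0 rho) g ->
  exists2 w1, square w0 rho w1 & forall w, square w0 rho w -> nm (g w) <= nm (g w1).
Proof.
move=> rho0 cg.
have [|w1 Dw1 h1] := square_lsc_min (w0 := w0) (f := fun w => - nm (g w)) rho0.
  move=> x Dx e e0; have [d d0 h] := cg x Dx e e0.
  exists d => // y Dy yx; have := h y Dy yx.
  by have := nmD (g y - g x) (g x); rewrite subrK; lra.
by exists w1 => // w /h1; rewrite lerN2.
Qed.

Lemma square_unif_cont w0 rho g (e : R) : 0 < e -> cont_on (square w0 rho) g ->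
  exists2 d : R, 0 < d & forall x y, square w0 rho x -> square w0 rho y ->
    nm (y - x) < d -> nm (g y - g x) < e.
Proof.
move=> e0 cg; set D := square w0 rho.
have : \forall n \near \oo, forall x, D x -> D x -> forall y, D y ->
    nm (y - x) < n.+1%:R^-1 -> nm (g y - g x) < e.
  apply: square_near_covering => x Dx.
  have [|d d0 h] := cg x Dx (e / 2); first by lra.
  exists (d / 2); first by lra.
  near=> n => y yx Dy z Dz zy.
  have nd : (n.+1%:R^-1 : R) < d / 2 by near: n; apply: near_inv_lt; lra.
  have zx : nm (z - x) < d.
    move: nd zy; set k := n.+1%:R^-1 => nd zy.
    by have := nmD (z - y) (y - x); rewrite addrA subrK; lra.
  have yx' : nm (y - x) < d by lra.
  have := h y Dy yx'; have := h z Dz zx; rewrite (nmB (g y)).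
  by have := nmD (g z - g x) (g x - g y); rewrite addrA subrK; lra.
move=> [n _ /(_ n (leqnn n)) h]; exists n.+1%:R^-1; first by rewrite invr_gt0.
by move=> x y Dx Dy; exact: h.
Unshelve. all: by end_near. Qed.

(** * Continuous square roots *)

Lemma sqrtc_Re_ge0 x : 0 <= Re (sqrtc x).
Proof. by case: x => a b /=; exact: sqrtr_ge0. Qed.

Lemma sqrtc_Re_gt0 x : 0 < Re x -> 0 < Re (sqrtc x).
Proof.
move=> x0; rewrite lt_def sqrtc_Re_ge0 andbT; apply: contraTneq x0.
rewrite -{2}(sqr_sqrtc x); case: (sqrtc x) => a b /= ->.
by rewrite mul0r sub0r -leNgt oppr_le0 -expr2 sqr_ge0.
Qed.

(** The two roots have difference times sum equal to [y - x], and the sum has modulus at least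
    [Re (sqrtc x) > 0]. *)
Lemma sqrtc_cont : cont_on [set x : C | 0 < Re x] (@sqrtc R).
Proof.
move=> x /= x0 e e0; have k0 := sqrtc_Re_gt0 x0.
exists (e * Re (sqrtc x)); first exact: mulr_gt0.
move=> y /= /sqrtc_Re_gt0 y0 yx.
set sx : C := sqrtc x in k0 yx *; set sy : C := sqrtc y in y0 *.
have l : Re sx <= nm (sy + sx).
  by have := nm_Re (sy + sx); rewrite ReD; have := ler_norm (Re sy + Re sx); lra.
have E : nm (sy - sx) * nm (sy + sx) = nm (y - x).
  by rewrite -nmM -subr_sqr -(sqr_sqrtc x) -(sqr_sqrtc y).
rewrite -(ltr_pM2r k0); apply: le_lt_trans yx.
by rewrite -E ler_wpM2l // nm_ge0.
Qed.

(** The root is continued along the radii from [w0] in [N] small steps. At each step the ratio of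
    consecutive values of [phi] lies within distance 1 of 1, so its principal square root is
    continuous and serves as correction factor. *)
Lemma sqrt_lift w0 rho (phi : C -> C) (s0 : C) : 0 <= rho ->
  cont_on (square w0 rho) phi -> (forall w, square w0 rho w -> phi w != 0) ->
  s0 ^+ 2 = phi w0 ->
  exists sigma : C -> C, [/\ cont_on (square w0 rho) sigma, sigma w0 = s0 &
    forall w, square w0 rho w -> sigma w ^+ 2 = phi w].
Proof.
move=> rho0 cphi phi0 s02; set D := square w0 rho.
have [w1 Dw1 hm] := square_min rho0 cphi.
have m0 : 0 < nm (phi w1) by rewrite nm_gt0 phi0.
have [d d0 hd] := square_unif_cont m0 cphi.
pose N := (Num.bound (2 * rho / d)).+1.
have N0 : 0 < (N%:R : R) by rewrite ltr0n.
(* Consecutive points [pt k w] and [pt k.+1 w] are at most [2 * rho / N] apart, hence closer than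
   [d], and [phi] changes by less than its minimum modulus. *)
have hN : 2 * rho < d * N%:R.
  rewrite [d * _]mulrC -ltr_pdivrMr //.
  have : 2 * rho / d < (Num.bound (2 * rho / d))%:R.
    by apply: archi_boundP; rewrite divr_ge0 ?mulr_ge0 // ltW.
  by move=> h; apply: lt_trans h _; rewrite ltr_nat.
pose pt (k : nat) w := w0 + rc (k%:R / N%:R) * (w - w0).
have Dpt k w : (k <= N)%N -> D w -> D (pt k w).
  move=> kN; apply: square_scale; rewrite divr_ge0 //=.
  by rewrite ler_pdivrMr // mul1r ler_nat.
have cpt k : cont_on D (pt k).
  apply: cont_onD; first exact: cont_on_cst.
  apply: cont_onM; first exact: cont_on_cst.
  by apply: cont_onD; [exact: cont_on_id|exact: cont_on_cst].
have cphipt k : (k <= N)%N -> cont_on D (fun w => phi (pt k w)).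
  by move=> kN; apply: (cont_on_comp _ (cpt k) cphi) => w; exact: Dpt.
suff /(_ N (leqnn N)) [sigma [cs s0E sE]] : forall k, (k <= N)%N ->
    exists sigma : C -> C, [/\ cont_on D sigma, sigma w0 = s0 &
      forall w, D w -> sigma w ^+ 2 = phi (pt k w)].
  exists sigma; split => // w Dw; rewrite sE //; congr phi.
  by rewrite /pt divff ?gt_eqF // rc1 mul1r addrC subrK.
elim=> [_|k IH kN].
  exists (fun=> s0); split => //; first exact: cont_on_cst.
  by move=> w _; rewrite /pt mul0r rc0 mul0r addr0.
have [sigma [cs s0E sE]] := IH (ltnW kN).
pose q w := phi (pt k.+1 w) / phi (pt k w).
have ph0 w : D w -> phi (pt k w) != 0.
  by move=> Dw; apply: phi0; apply: Dpt; rewrite // ltnW.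
have cq : cont_on D q.
  apply: cont_onM; first exact: cphipt.
  by apply: cont_onV => //; apply: cphipt; exact: ltnW.
have Rq w : D w -> 0 < Re (q w).
  move=> Dw; suff : nm (q w - 1) < 1.
    by have := nm_Re (q w - 1); rewrite ReD ReN /= ler_norml; lra.
  have -> : q w - 1 = (phi (pt k.+1 w) - phi (pt k w)) / phi (pt k w).
    by rewrite /q; field; exact: ph0.
  rewrite nmM nmV ltr_pdivrMr ?nm_gt0 ?ph0 // mul1r.
  apply: lt_le_trans (hm _ (Dpt _ _ (ltnW kN) Dw)).
  apply: hd; [exact: Dpt (ltnW kN) Dw|exact: Dpt|].
  have -> : pt k.+1 w - pt k w = rc N%:R^-1 * (w - w0).
    rewrite /pt -natr1 mulrDl mul1r rcD; ring.
  rewrite nmM nm_rc gtr0_norm ?invr_gt0 // mulrC ltr_pdivrMr //.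
  exact: le_lt_trans (square_nm Dw) hN.
exists (fun w => sigma w * sqrtc (q w)); split.
- apply: cont_onM => //.
  exact: (cont_on_comp _ cq sqrtc_cont).
- have -> : q w0 = 1.
    by rewrite /q /pt subrr !mulr0 addr0 divff //; apply: phi0; exact: square_center.
  by rewrite sqrtc1 mulr1.
- move=> w Dw; rewrite exprMn sE // sqr_sqrtc /q.
  by rewrite mulrC divfK // ph0.
Qed.

End square.

(** * Quadratic chains and their inverse branches *)

Section derivative_bounds.
Variable R : realType.
Local Notation C := (Cx R).
Implicit Types (z w : C) (rho M : R).

(** Since the difference quotient is a polynomial, modulus principles for polynomials suffice to
    estimate derivatives. *)
Lemma poly_quotient (P : {poly C}) z0 :
  exists2 Q : {poly C}, Q.[z0] = (P^`()).[z0] &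
    forall z, P.[z] - P.[z0] = Q.[z] * (z - z0).
Proof.
have /factor_theorem [Q PQ] : root (P - (P.[z0])%:P) z0.
  by rewrite /root hornerD hornerN hornerC subrr.
exists Q.
  have : (P - (P.[z0])%:P)^`().[z0] = Q.[z0].
    rewrite PQ derivM derivXsubC hornerD !hornerM hornerXsubC subrr mulr0 add0r.
    by rewrite hornerC mulr1.
  by rewrite derivB derivC subr0.
move=> z; have : (P - (P.[z0])%:P).[z] = Q.[z] * (z - z0).
  by rewrite PQ hornerM hornerXsubC.
by rewrite hornerD hornerN hornerC.
Qed.

Lemma poly_size_le1 (Q : {poly C}) z w : (size Q <= 1)%N -> Q.[z] = Q.[w].
Proof. by move/size1_polyC ->; rewrite !hornerC. Qed.

Lemma square_corner w0 rho : 0 <= rho ->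
  square w0 rho (w0 + rc rho) /\ nm (w0 + rc rho - w0) = rho.
Proof.
move=> rho0; rewrite /square /= addrC addKr nm_rc /= !normr0.
by rewrite ger0_norm.
Qed.

(** Cauchy's estimate via the maximum principle for the difference quotient [Q]: at distance at
    least [rho] from [z0] the bound is immediate, and a maximum of the modulus of [Q] nearer to [z0]
    forces [Q] to be constant or zero there. *)
Lemma poly_deriv_upper (P : {poly C}) z0 rho M : 0 < rho ->
  (forall z, square z0 rho z -> nm P.[z] <= M) ->
  nm (P^`()).[z0] <= 2 * M / rho.
Proof.
move=> rho0 PM; have rho0' := ltW rho0.
have [Q <- PQ] := poly_quotient P z0.
have bd w : square z0 rho w -> rho <= nm (w - z0) -> nm Q.[w] <= 2 * M / rho.
  move=> Dw wr; rewrite ler_pdivlMr //.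
  have l : nm Q.[w] * rho <= nm Q.[w] * nm (w - z0) by rewrite ler_wpM2l ?nm_ge0.
  have := nmD P.[w] (- P.[z0]); rewrite PQ nmM nmN.
  by have := PM w Dw; have := PM z0 (square_center z0 rho0'); lra.
have [Dc nc] := square_corner z0 rho0'.
have [w1 Dw1 h] := square_max rho0' (cont_on_poly Q (D := square z0 rho)).
have h0 := h _ (square_center z0 rho0').
have [wr|wr] := leP rho (nm (w1 - z0)).
  exact: le_trans h0 (bd _ Dw1 wr).
have [sQ|sQ] := leqP (size Q) 1.
  by rewrite (poly_size_le1 z0 (z0 + rc rho) sQ) bd // nc.
have [Q0|Q0] := eqVneq Q.[w1] 0.
  apply: le_trans h0 _; rewrite Q0 nm0.
  by apply: le_trans (nm_ge0 _) (bd _ Dc _); rewrite nc.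
have [eta eta0 he] := square_interior Dw1 wr.
have [z zw] := poly_no_local_max sQ Q0 eta0.
by rewrite ltNge h //; exact: he.
Qed.

(* The triple [(a, b, e)] stands for the quadratic map [z |-> a (z - b)^2 + e],
   whose only critical value is [e]. *)
Definition quad_eval (q : C * C * C) z := q.1.1 * (z - q.1.2) ^+ 2 + q.2.

Fixpoint chain (s : seq (C * C * C)) z :=
  if s is q :: s' then chain s' (quad_eval q z) else z.

Fixpoint chain_poly (s : seq (C * C * C)) : {poly C} :=
  if s is q :: s' then
    chain_poly s' \Po (q.1.1 *: ('X - q.1.2%:P) ^+ 2 + q.2%:P)
  else 'X.

Fixpoint chain_deriv (s : seq (C * C * C)) z :=
  if s is q :: s' then
    2 * q.1.1 * (z - q.1.2) * chain_deriv s' (quad_eval q z)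
  else 1.

Lemma quad_evalE (q : C * C * C) z :
  (q.1.1 *: ('X - q.1.2%:P) ^+ 2 + q.2%:P).[z] = quad_eval q z.
Proof. by rewrite hornerD hornerZ horner_exp hornerXsubC hornerC. Qed.

Lemma chain_polyE s z : (chain_poly s).[z] = chain s z.
Proof.
elim: s z => [|q s IH] z /=; first by rewrite hornerX.
by rewrite horner_comp IH quad_evalE.
Qed.

Lemma chain_poly_deriv s z : ((chain_poly s)^`()).[z] = chain_deriv s z.
Proof.
elim: s z => [|q s IH] z /=; first by rewrite derivX hornerC.
rewrite deriv_comp hornerM horner_comp IH quad_evalE derivD derivZ derivC addr0.
rewrite deriv_exp derivXsubC hornerZ mul1r hornerMn expr1 hornerXsubC mulrC.
by rewrite -mulr_natl; congr (_ * _); ring.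
Qed.

Lemma chain_cont (D : set C) s : cont_on D (chain s).
Proof.
by apply: eq_cont_on (cont_on_poly (chain_poly s)) => z _; rewrite chain_polyE.
Qed.

(** The last clause makes [psi] a two-sided local inverse: all points near [psi w] are again values
    of [psi]. This lets a local minimum principle be used on the image of [psi]. *)
Definition inverse_branch (D : set C) w0 rho s z0 (U : set C) (psi : C -> C) :=
  [/\ cont_on D psi, psi w0 = z0, forall w, D w -> chain s (psi w) = w,
      forall w, D w -> U (psi w) &
      forall w, D w -> nm (w - w0) < rho -> exists2 eta : R, 0 < eta &
        forall z, nm (z - psi w) < eta -> D (chain s z) /\ psi (chain s z) = z].

(** Induction from the last map of the chain backwards. A branch with values in [U] misses the
    critical value [e] of the preceding map, so [(psi - e) / a] has no zero and admits a continuous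
    square root; backward invariance keeps the new branch in [U]. *)
Lemma inverse_branch_exists (U : set C) s z0 w0 rho : 0 <= rho ->
  (forall w, square w0 rho w -> U w) ->
  (forall q, q \in s ->
     [/\ q.1.1 != 0, ~ U q.2 & forall z, U (quad_eval q z) -> U z]) ->
  chain s z0 = w0 ->
  exists psi, inverse_branch (square w0 rho) w0 rho s z0 U psi.
Proof.
move=> rho0 DU; elim: s z0 => [|[[a b] e] s IH] z0 sU /= zw.
  exists id; split => //; first exact: cont_on_id.
  move=> w Dw wr; have [eta eta0 h] := square_interior Dw wr.
  by exists eta => // z /h.
set D := square w0 rho in IH DU *; set q := (a, b, e) in sU zw *.
have qE z : quad_eval q z = a * (z - b) ^+ 2 + e by [].
have [/= a0 nUe qU] := sU q (mem_head _ _).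
have [|psi [cpsi psi0 psiK psiU psil]] := IH (quad_eval q z0) _ zw.
  by move=> p ps; apply: sU; rewrite inE ps orbT.
have ne w : D w -> psi w - e != 0.
  by move=> Dw; rewrite subr_eq0; apply: contra_notN nUe => /eqP <-; exact: psiU.
have [||| sigma [cs s0 sE]] :=
    @sqrt_lift R w0 rho (fun w => (psi w - e) / a) (z0 - b) rho0.
- apply: cont_onM; last exact: cont_on_cst.
  by apply: cont_onD => //; exact: cont_on_cst.
- by move=> w Dw; rewrite mulf_neq0 ?invr_eq0 ?ne.
- by rewrite psi0 qE addrK mulrC mulKf.
have qs w : D w -> quad_eval q (b + sigma w) = psi w.
  by move=> Dw; rewrite qE [b + _]addrC addrK sE // [a * _]mulrC divfK // subrK.
exists (fun w => b + sigma w); split.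
- by apply: cont_onD => //; exact: cont_on_cst.
- by rewrite s0 addrC subrK.
- by move=> w Dw; rewrite /= qs // psiK.
- by move=> w Dw; apply: qU; rewrite qs //; exact: psiU.
move=> w Dw wr; have [eta eta0 h] := psil w Dw wr.
set z1 := b + sigma w.
have c1 : chain (q :: s) z1 = w by rewrite /= qs // psiK.
have sg0 : 0 < nm (sigma w).
  by rewrite nm_gt0 -sqrf_eq0 sE // mulf_neq0 ?invr_eq0 ?ne.
have sg2 : 0 < nm (sigma w) / 2 by lra.
have [d1 d10 h1] := chain_cont [:: q] (D := setT) (x := z1) I eta0.
have [d2 d20 h2] := cs w Dw _ sg2.
have [d3 d30 h3] := chain_cont (q :: s) (D := setT) (x := z1) I d20.
(* Both [z] and the new branch stay within [nm (sigma w) / 2] of their values at [w], which excludes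
   the other root [b - sigma y]: it would give [2 * nm (sigma w) < nm (sigma w)]. *)
exists (Num.min (Num.min d1 d3) (nm (sigma w) / 2)); first by rewrite !lt_min d10 d30.
move=> z; rewrite !lt_min => /andP[/andP[/(h1 _ I) + /(h3 _ I)]].
rewrite c1 [chain [:: q] z1]/= qs // => zq zc zs.
have [Dc psic] := h _ zq; split => //=.
set y := chain s _ in Dc psic *.
have ys := h2 y Dc zc.
have : (sigma y - (z - b)) * (sigma y + (z - b)) == 0.
  by rewrite -subr_sqr sE // psic /= qE addrK mulrC mulKf // subrr.
rewrite mulf_eq0 => /orP[|/eqP sz].
  by rewrite subr_eq0 => /eqP ->; rewrite addrC subrK.
have E : 2 * sigma w = (sigma w - sigma y) + (z1 - z).
  have -> : z = b - sigma y by apply: subr0_eq; rewrite -[RHS]sz; ring.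
  by rewrite /z1; ring.
have := nmD (sigma w - sigma y) (z1 - z); rewrite -E nmM (nmB z1) (nmB (sigma w)).
rewrite -(rc_nat R 2) nm_rc ger0_norm //.
by move=> l; exfalso; lra.
Qed.

(* Schwarz lemma for the inverse branch [psi] at [w0]. Instead of [psi] itself,
   the minimum modulus principle is applied to the polynomial
   [(P z - w0) / (z - z0)] on the image of [psi]. *)
Lemma chain_deriv_lower (U : set C) s z0 w0 rho M : 0 < rho -> 0 < M ->
  (forall w, square w0 rho w -> U w) -> (forall w, U w -> nm w <= M) ->
  (forall q, q \in s ->
     [/\ q.1.1 != 0, ~ U q.2 & forall z, U (quad_eval q z) -> U z]) ->
  chain s z0 = w0 -> chain_deriv s z0 != 0 ->
  rho / (2 * M) <= nm (chain_deriv s z0).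
Proof.
move=> rho0 M0 DU UM sU zw dz; have rho0' := ltW rho0.
have [psi [cpsi psi0 psiK psiU psil]] := inverse_branch_exists rho0' DU sU zw.
have [Q] := poly_quotient (chain_poly s) z0.
rewrite chain_poly_deriv => Q0 PQ; rewrite -Q0.
set D := square w0 rho in cpsi psiK psiU psil *.
have Dw0 : D w0 by exact: square_center.
have PQ' w : D w -> w - w0 = Q.[psi w] * (psi w - z0).
  by move=> Dw; rewrite -PQ !chain_polyE zw psiK.
have bd w : D w -> rho <= nm (w - w0) -> rho / (2 * M) <= nm Q.[psi w].
  move=> Dw wr; rewrite ler_pdivrMr ?mulr_gt0 //; apply: le_trans wr _.
  rewrite PQ' // nmM ler_wpM2l ?nm_ge0 //.
  have := nmD (psi w) (- z0); rewrite nmN -psi0.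
  by have := UM _ (psiU _ Dw); have := UM _ (psiU _ Dw0); lra.
have [Dc nc] := square_corner w0 rho0'.
have [w1 Dw1 h] := square_min rho0' (cont_on_comp (E := setT) (fun _ _ => I) cpsi
  (@cont_on_poly R setT Q)).
have h0 : nm Q.[psi w1] <= nm Q.[z0] by rewrite -psi0; exact: h.
have [wr|wr] := leP rho (nm (w1 - w0)).
  exact: le_trans (bd _ Dw1 wr) h0.
have [sQ|sQ] := leqP (size Q) 1.
  by rewrite (poly_size_le1 z0 (psi (w0 + rc rho)) sQ) bd // nc.
(* A zero of [Q] at [psi w1] would force [w1 = w0], so the derivative at [z0] would vanish. *)
have Qn0 : Q.[psi w1] != 0.
  apply/negP => /eqP Qw1; have /eqP := PQ' _ Dw1; rewrite Qw1 mul0r subr_eq0 => /eqP w10.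
  by move: dz; rewrite -Q0 -psi0 -w10 Qw1 eqxx.
have [eta eta0 he] := psil _ Dw1 wr.
have [z /he [Dz <-]] := poly_no_local_min sQ Qn0 eta0.
by rewrite ltNge h.
Qed.

End derivative_bounds.

(** * The semigroup *)

Section semigroup.
Variable R : realType.
Local Notation C := (Cx R).
Implicit Types (z w : C) (K U : set C) (s : seq C).

Lemma bernoulli (e : R) n : 0 <= e -> 1 + n%:R * e <= (1 + e) ^+ n.
Proof.
move=> e0; elim: n => [|n IH]; first by rewrite mul0r addr0 expr0.
rewrite exprS -natr1; have : (1 + e) * (1 + n%:R * e) <= (1 + e) * (1 + e) ^+ n.
  by rewrite ler_wpM2l // addr_ge0.
have : 0 <= n%:R * e * e by rewrite !mulr_ge0.
lra.
Qed.

Lemma expn_unbounded (e B : R) : 0 < e ->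
  exists n, forall m, (n <= m)%N -> B < (1 + e) ^+ m.
Proof.
move=> e0; exists (Num.bound (`|B| / e)) => m nm.
apply: lt_le_trans (bernoulli m (ltW e0)).
have : `|B| / e < m%:R.
  apply: lt_le_trans (archi_boundP _) _; last by rewrite ler_nat.
  by rewrite divr_ge0 // ltW.
by rewrite ltr_pdivrMr //; have := ler_norm B; lra.
Qed.

(** * Words, their orbits and multipliers *)

Fixpoint orb s z := if s is c :: s' then orb s' (z ^+ 2 + c) else z.

Fixpoint mult s z := if s is c :: s' then 2 * z * mult s' (z ^+ 2 + c) else 1.

Lemma orb_cat s t z : orb (s ++ t) z = orb t (orb s z).
Proof. by elim: s z => /=. Qed.

Lemma mult_cat s t z : mult (s ++ t) z = mult s z * mult t (orb s z).
Proof. by elim: s z => [|c s IH] z /=; rewrite ?mul1r // IH mulrA. Qed.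

Lemma word_power s z k : orb s z = z ->
  exists t, [/\ {subset t <= s}, size t = (k * size s)%N, orb t z = z &
    mult t z = mult s z ^+ k].
Proof.
move=> sz; elim: k => [|k [t [ts st tz mt]]]; first by exists [::].
exists (s ++ t); split; rewrite ?orb_cat ?mult_cat ?size_cat ?st ?sz ?mt ?exprS //.
by move=> x; rewrite mem_cat => /orP[//|/ts].
Qed.

Lemma fpoly_comp_orb s z : (fpoly_comp s).[z] = orb s z /\
  ((fpoly_comp s)^`()).[z] = mult s z.
Proof.
rewrite /fpoly_comp; set X : {poly C} := 'X.
(* The accumulator of [foldl] must be arbitrary for the induction. *)
suff h P : (foldl (fun P c => fpoly c \Po P) P s).[z] = orb s P.[z] /\
  ((foldl (fun P c => fpoly c \Po P) P s)^`()).[z] = mult s P.[z] * (P^`()).[z].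
  by have [-> ->] := h X; rewrite hornerX derivX hornerC mulr1.
have fE (c w : C) : (fpoly c).[w] = w ^+ 2 + c.
  by rewrite /fpoly hornerD hornerXn hornerC.
elim: s P => [|c s IH] P /=; first by rewrite mul1r.
have [-> ->] := IH (fpoly c \Po P); rewrite horner_comp fE; split => //.
rewrite deriv_comp hornerM horner_comp /fpoly derivD derivC addr0 derivXn expr1.
by rewrite hornerMn hornerX -mulr_natl; ring.
Qed.

Lemma poly_iter_word s q : exists t, [/\ {subset t <= s}, size t = (q * size s)%N &
  forall z, (poly_iter (fpoly_comp s) q).[z] = orb t z /\
    ((poly_iter (fpoly_comp s) q)^`()).[z] = mult t z].
Proof.
elim: q => [|q [t [ts st h]]].
  by exists [::]; split => // z /=; rewrite /poly_iter /= hornerX derivX hornerC.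
exists (t ++ s); split.
- by move=> x; rewrite mem_cat => /orP[/ts|].
- by rewrite size_cat st addnC.
move=> z; have [h1 h2] := h z; rewrite /poly_iter /= -/(poly_iter _ _).
rewrite deriv_comp hornerM !horner_comp h1 h2 orb_cat mult_cat.
by have [-> ->] := fpoly_comp_orb s (orb t z); rewrite mulrC.
Qed.

(** Repeating the cycle [m] times turns its multiplier, an [m]-th root of unity, into 1; further
    repetition makes the word as long as desired. *)
Lemma parabolic_words s z : (0 < size s)%N ->
  parabolic_periodic_point (fpoly_comp s) z ->
  forall n, exists t, [/\ {subset t <= s}, (n <= size t)%N, (0 < size t)%N,
    orb t z = z & mult t z = 1].
Proof.
move=> s0 [q [q0 [qz [m [m0 hm]]]]] n.
have [t [ts st h]] := poly_iter_word s q; have [h1 h2] := h z.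
have [v [vt sv vz mv]] := word_power (m * n.+1) (etrans (esym h1) qz).
have lv : (n.+1 <= size v)%N.
  by rewrite sv st mulnAC; apply: leq_pmull; rewrite !muln_gt0 m0 q0 s0.
exists v; split => //; first by move=> x /vt/ts.
- exact: ltnW.
- exact: leq_trans lv.
- by rewrite mv exprM -h2 hm expr1n.
Qed.

(** Here [(M - 1)^2 - (M - 5) - M = (M - 2)^2 + 2 > 0]. Read backwards: preimages of the disc of
    radius [M] lie in the disc of radius [M - 1]. *)
Lemma nm_sqD_escape (z c : C) (M : R) : nm c <= M - 5 -> M - 1 < nm z ->
  M < nm (z ^+ 2 + c).
Proof.
move=> cM zM; have := nmD_ge (z ^+ 2) c; rewrite nmX.
have := nm_ge0 c => c0.
have : (M - 1) * (M - 1) <= nm z ^+ 2 by rewrite expr2 ler_pM; lra.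
have : 0 <= (M - 2) * (M - 2) by rewrite -expr2 sqr_ge0.
lra.
Qed.

(** * Sets mapped inside themselves with a margin *)

Definition inner K (d : R) : set C := [set z | forall u, nm u <= d -> K (z + u)].

Lemma inner_sub K d z : 0 <= d -> inner K d z -> K z.
Proof. by move=> d0 /(_ 0); rewrite addr0 nm0; exact. Qed.

Definition maps_inside K (c : C) (r d : R) :=
  forall c' z, nm (c' - c) <= r -> K z -> inner K d (z ^+ 2 + c').

Definition nm_closed K := forall w, ~ K w ->
  exists2 eta : R, 0 < eta & forall y, nm (y - w) < eta -> ~ K y.

Lemma orb_in K c r d s z : 0 <= d -> maps_inside K c r d ->
  (forall c', c' \in s -> nm (c' - c) <= r) -> K z -> K (orb s z).
Proof.
move=> d0 Kin; elim: s z => [//|a s IH] z sr Kz /=; apply: IH.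
  by move=> c' c's; apply: sr; rewrite inE c's orbT.
by apply: (inner_sub d0); apply: Kin => //; apply: sr; rewrite mem_head.
Qed.

Lemma orb_inner K c r d s z : 0 <= d -> maps_inside K c r d ->
  (forall c', c' \in s -> nm (c' - c) <= r) -> (0 < size s)%N ->
  K z -> inner K d (orb s z).
Proof.
move=> d0 Kin; case/lastP: s => [//|s a] sr _ Kz.
rewrite -cats1 orb_cat /=; apply: (Kin); first by apply: sr; rewrite mem_rcons mem_head.
by apply: (orb_in d0 Kin) => // c' c's; apply: sr; rewrite mem_rcons inE c's orbT.
Qed.

(* The maps [w |-> f w + e (f w - f z)] along the orbit of [z] follow that orbit
   with multipliers enlarged by [1 + e]. *)
Fixpoint fwd (e : R) s z := if s is c :: s' then
  (rc (1 + e), 0 : C, rc (1 + e) * c - rc e * (z ^+ 2 + c)) :: fwd e s' (z ^+ 2 + c)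
  else [::].

Lemma chain_deriv_fwd e s z :
  chain_deriv (fwd e s z) z = rc (1 + e) ^+ size s * mult s z.
Proof.
elim: s z => [|c s IH] z /=; first by rewrite mulr1.
have -> : quad_eval (rc (1 + e), 0 : C, rc (1 + e) * c - rc e * (z ^+ 2 + c)) z =
  z ^+ 2 + c by rewrite /quad_eval /= rcD rc1; ring.
rewrite IH [rc _ ^+ _.+1]exprS; set X := rc _ ^+ size s.
by set m := mult s _; ring.
Qed.

(** The added term [e (f w - f z)] has modulus at most [e * (2 * M) <= d], so the margin absorbs
    it. *)
Lemma chain_fwd_in K c r d e M s z w : 0 <= d -> maps_inside K c r d ->
  0 <= e -> e * (2 * M) <= d -> (forall x, K x -> nm x <= M) ->
  (forall c', c' \in s -> nm (c' - c) <= r) ->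
  K z -> K w -> K (chain (fwd e s z) w).
Proof.
move=> d0 Kin e0 eM KM; elim: s z w => [//|a s IH] z w sr Kz Kw /=.
have ar : nm (a - c) <= r by apply: sr; rewrite mem_head.
have Kz' : K (z ^+ 2 + a) by apply: (inner_sub d0); exact: Kin.
have Kw' : K (w ^+ 2 + a) by apply: (inner_sub d0); exact: Kin.
apply: IH => //; first by move=> c' c's; apply: sr; rewrite inE c's orbT.
have -> : quad_eval (rc (1 + e), 0 : C, rc (1 + e) * a - rc e * (z ^+ 2 + a)) w =
  w ^+ 2 + a + rc e * ((w ^+ 2 + a) - (z ^+ 2 + a)).
  by rewrite /quad_eval /= rcD rc1; ring.
apply: Kin => //; rewrite nmM nm_rc ger0_norm //; apply: le_trans eM.
rewrite ler_wpM2l //; have := nmD (w ^+ 2 + a) (- (z ^+ 2 + a)).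
by rewrite nmN; have := KM _ Kz'; have := KM _ Kw'; lra.
Qed.

(** Cauchy's estimate for the enlarged chain, bounded by [M] on the square of half-side [d / 2]
    about [z]; this square lies in [K] because [z] is inner. *)
Lemma mult_upper K c r d M : 0 < d -> 0 < M -> maps_inside K c r d ->
  (forall x, K x -> nm x <= M) ->
  exists2 e : R, 0 < e & exists B : R, forall s z,
    (forall c', c' \in s -> nm (c' - c) <= r) -> inner K d z ->
    nm (mult s z) * (1 + e) ^+ size s <= B.
Proof.
move=> d0 M0 Kin KM; have d0' := ltW d0.
exists (d / (2 * M)); first by rewrite divr_gt0 // mulr_gt0.
exists (2 * M / (d / 2)) => s z sr zin; set e := d / (2 * M).
have e0 : 0 < e by rewrite divr_gt0 // mulr_gt0.
have eM : e * (2 * M) <= d by rewrite /e divfK // gt_eqF // mulr_gt0.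
have -> : nm (mult s z) * (1 + e) ^+ size s = nm (chain_deriv (fwd e s z) z).
  by rewrite chain_deriv_fwd nmM nmX nm_rc ger0_norm ?addr_ge0 ?ltW // mulrC.
rewrite -chain_poly_deriv; apply: poly_deriv_upper; first by rewrite divr_gt0.
move=> w /square_nm; have -> : 2 * (d / 2) = d by field.
move=> wz; rewrite chain_polyE; apply: (KM).
apply: (chain_fwd_in d0' Kin (ltW e0) eM KM sr); first exact: (inner_sub d0').
by rewrite -(subrK z w) addrC; exact: zin.
Qed.

Lemma zero_in K c r d M ct : 0 < d -> 0 < M -> maps_inside K c r d ->
  (forall x, K x -> nm x <= M) -> K !=set0 -> nm_closed K ->
  nm (ct - c) <= r -> superattracting ct -> K 0.
Proof.
move=> d0 M0 Kin KM [y Ky] Kcl ctr [p [p0 fp]]; apply: contrapT => nK0.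
have d0' := ltW d0.
have [e e0 [B hB]] := mult_upper d0 M0 Kin KM.
set f := fun z : C => z ^+ 2 + ct in fp.
have Kf z : K z -> K (f z) by move=> Kz; apply: (inner_sub d0'); exact: Kin.
have fpk k : iter (k * p) f 0 = 0.
  by elim: k => [//|k IH]; rewrite mulSn iterD IH fp.
(* A point of the cycle of 0 in [K] would bring 0 into [K] by forward invariance. *)
have nKP i : ~ K (iter i f 0).
  move=> Ki; apply: nK0; rewrite -(fpk i) -(subnK (leq_pmulr i p0)) iterD.
  by elim: (_ - _)%N => [//|k IH] /=; exact: Kf.
have [eta eta0 heta] : exists2 eta : R, 0 < eta &
    forall i w, nm (w - iter i f 0) < eta -> ~ K w.
  suff [eta eta0 h] : exists2 eta : R, 0 < eta &
      forall i, (i < p)%N -> forall w, nm (w - iter i f 0) < eta -> ~ K w.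
    exists eta => // i; rewrite (divn_eq i p) addnC iterD fpk.
    by apply: h; rewrite ltn_mod.
  elim: (p) => [|k [eta eta0 h]]; first by exists 1.
  have [eta' eta'0 h'] := Kcl _ (nKP k).
  exists (Num.min eta eta'); first by rewrite lt_min eta0.
  move=> i; rewrite ltnS leq_eqVlt => /orP[/eqP ->|ik] w; rewrite lt_min => /andP[].
    by move=> _; exact: h'.
  by move=> + _; exact: h.
pose M' := M + nm ct + 5; have ct0 := nm_ge0 ct.
(* Removing the whole cycle of 0 removes the critical value [ct] and keeps [U] backward
   invariant. *)
pose U : set C := [set w | nm w <= M' /\ forall i, w <> iter i f 0].
pose rho := Num.min eta 1 / 4.
have rho0 : 0 < rho by rewrite divr_gt0 // lt_min eta0 ltr01.
have rho_eta : 2 * rho < eta.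
  have : Num.min eta 1 <= eta by rewrite ge_min lexx.
  by rewrite /rho; lra.
have rho1 : 2 * rho < 1.
  have : Num.min eta 1 <= 1 by rewrite ge_min lexx orbT.
  by rewrite /rho; lra.
have M'0 : 0 < M' by rewrite /M'; lra.
(* For this [n] the lower bound [rho / (2 * M')] on the multiplier exceeds the upper bound
   [B / (1 + e) ^+ n]. *)
have [n hn] := expn_unbounded (B * (2 * M' / rho)) e0.
pose z0 := f y; have z0in : inner K d z0 by exact: Kin.
pose s := nseq n ct; pose q : C * C * C := (1, 0, ct).
have sr c' : c' \in s -> nm (c' - c) <= r by move=> /nseqP[->].
have qE w : quad_eval q w = f w by rewrite /quad_eval /= mul1r subr0.
have chE z : chain (nseq n q) z = orb s z.
  by rewrite /s; elim: (n) z => [//|m IH] z /=; rewrite IH qE.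
have dE z : chain_deriv (nseq n q) z = mult s z.
  rewrite /s; elim: (n) z => [//|m IH] z /=.
  by rewrite IH qE mulr1 subr0.
have Kz0 : K z0 by exact: (inner_sub d0').
have m0 : mult s z0 != 0.
  rewrite /s; elim: (n) z0 Kz0 {z0in} => [|m IH] z Kz /=; first exact: oner_neq0.
  rewrite !mulf_neq0 ?pnatr_eq0 //; last exact: (IH (f z) (Kf _ Kz)).
  by apply: contra_notN nK0 => /eqP <-.
have Kw0 : K (orb s z0) by exact: (orb_in d0' Kin sr).
have := @chain_deriv_lower R U (nseq n q) z0 (orb s z0) rho M' rho0 M'0.
rewrite dE => /(_ _ _ _ (chE _) m0) low.
have {low} : rho / (2 * M') <= nm (mult s z0).
  apply: low.
  - move=> w /square_nm ww0; split.
      have := nmD (w - orb s z0) (orb s z0); rewrite subrK.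
      by have := KM _ Kw0; rewrite /M'; lra.
    move=> i wi; apply: (heta i (orb s z0)) Kw0; rewrite -wi nmB.
    exact: le_lt_trans ww0 _.
  - by move=> w [].
  - move=> _ /nseqP[-> _]; split => /=; first exact: oner_neq0.
      by move=> [_ /(_ 1%N)]; apply; rewrite /= /f expr0n add0r.
    move=> z; rewrite qE => -[fzM fzi]; split; last first.
      by move=> i zi; apply: (fzi i.+1); rewrite /= -zi.
    rewrite leNgt; apply/negP => zM.
    have cM : nm ct <= M' - 5 by rewrite /M'; lra.
    have zM' : M' - 1 < nm z by lra.
    by have := lt_le_trans (nm_sqD_escape cM zM') fzM; rewrite ltxx.
have := hB s z0 sr z0in; have := hn n (leqnn n); rewrite size_nseq => h1 h2 h3.
have : rho / (2 * M') * (1 + e) ^+ n <= B.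
  by apply: le_trans h2; rewrite ler_wpM2r // exprn_ge0 // addr_ge0 // ltW.
rewrite mulrAC ler_pdivrMr ?mulr_gt0 // => h4.
move: h1; rewrite mulrA ltr_pdivrMr // [_ * rho]mulrC => h1.
by have := lt_le_trans h1 h4; rewrite ltxx.
Qed.

(* The inverse branches [y] of [f] at [f z] are replaced by [y + e (y - z)], so
   multipliers along the orbit of [z] are divided by [1 + e]. *)
Fixpoint bwd (e : R) s z := if s is c :: s' then
  ((rc (1 + e) ^+ 2)^-1, - (rc e * z), c) :: bwd e s' (z ^+ 2 + c)
  else [::].

Lemma rc1D_neq0 (e : R) : 0 <= e -> rc (1 + e) != 0.
Proof. by move=> e0; rewrite -nm_gt0 nm_rc gtr0_norm; lra. Qed.

Lemma bwd_evalE (e : R) c z w : 0 <= e ->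
  quad_eval ((rc (1 + e) ^+ 2)^-1, - (rc e * z), c) w =
  ((w + rc e * z) / rc (1 + e)) ^+ 2 + c.
Proof. by move=> /rc1D_neq0 e0; rewrite /quad_eval /= opprK exprMn exprVn mulrC. Qed.

Lemma bwd_evalEz (e : R) c z : 0 <= e ->
  quad_eval ((rc (1 + e) ^+ 2)^-1, - (rc e * z), c) z = z ^+ 2 + c.
Proof.
move=> e0; rewrite bwd_evalE //; congr (_ ^+ 2 + _).
have := rc1D_neq0 e0; rewrite rcD rc1 => ?; by field.
Qed.

Lemma chain_bwd e s z : 0 <= e -> chain (bwd e s z) z = orb s z.
Proof.
by move=> e0; elim: s z => [//|c s IH] z /=; rewrite bwd_evalEz // IH.
Qed.

Lemma chain_deriv_bwd e s z : 0 <= e ->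
  mult s z = rc (1 + e) ^+ size s * chain_deriv (bwd e s z) z.
Proof.
move=> e0; have := rc1D_neq0 e0; elim: s z => [|c s IH] z E0 /=; first by rewrite mulr1.
rewrite bwd_evalEz // IH // [rc _ ^+ _.+1]exprS; set X := rc _ ^+ size s.
set m := chain_deriv _ _; set E := rc (1 + e) in E0 *.
have -> : z - - (rc e * z) = E * z by rewrite /E rcD rc1; ring.
by clearbody E; field.
Qed.

(** Inverse branches are taken in a large disc minus [inner K d]. That set omits every critical
    value [c' = 0 ^+ 2 + c'], because [K] contains 0, and preimages under the maps [f_c'] even leave
    [K], which gives room to perturb them. *)
Lemma mult_lower K c r d M zs : 0 < d -> 0 < M -> 0 <= r -> maps_inside K c r d ->
  (forall x, K x -> nm x <= M) -> nm_closed K -> K 0 -> ~ K zs ->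
  exists2 e : R, 0 < e & exists2 B : R, 0 < B & forall s,
    (forall c', c' \in s -> nm (c' - c) <= r) -> orb s zs = zs -> mult s zs != 0 ->
    B * (1 + e) ^+ size s <= nm (mult s zs).
Proof.
move=> d0 M0 r0 Kin KM Kcl K0 /[dup] nKzs /Kcl [eta eta0 heta].
have d0' := ltW d0; have c0 := nm_ge0 c; have zs0 := nm_ge0 zs.
pose M' := M + nm zs + nm c + r + 5; have M'0 : 0 < M' by rewrite /M'; lra.
pose U : set C := [set w | nm w <= M' /\ ~ inner K d w].
have step c' y : nm (c' - c) <= r -> U (y ^+ 2 + c') -> nm y <= M' - 1 /\ ~ K y.
  move=> c'r [yM yin]; split; last by move=> Ky; apply: yin; exact: Kin.
  rewrite leNgt; apply/negP => zM.
  have cM : nm c' <= M' - 5 by have := nmD (c' - c) c; rewrite subrK /M'; lra.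
  by have := lt_le_trans (nm_sqD_escape cM zM) yM; rewrite ltxx.
pose rho := Num.min eta 1 / 4.
have rho0 : 0 < rho by rewrite divr_gt0 // lt_min eta0 ltr01.
have rho_eta : 2 * rho < eta.
  have : Num.min eta 1 <= eta by rewrite ge_min lexx.
  by rewrite /rho; lra.
have rho1 : 2 * rho < 1.
  have : Num.min eta 1 <= 1 by rewrite ge_min lexx orbT.
  by rewrite /rho; lra.
(* Perturbed preimages move by at most [e * (2 * M') = d1]. The bound [d] keeps them out of
   [inner K d]; the bound 1 keeps them in the disc of radius [M'], as preimages have modulus at most
   [M' - 1]. *)
pose d1 := Num.min d 1; have d10 : 0 < d1 by rewrite lt_min d0 ltr01.
have d1d : d1 <= d by rewrite ge_min lexx.
have d11 : d1 <= 1 by rewrite ge_min lexx orbT.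
pose e := d1 / (2 * M'); have e0 : 0 < e by rewrite divr_gt0 // mulr_gt0.
have e0' := ltW e0.
have eM : e * (2 * M') = d1 by rewrite /e divfK // gt_eqF // mulr_gt0.
have DU w : square zs rho w -> U w.
  move=> /square_nm wzs; split.
    by have := nmD (w - zs) zs; rewrite subrK /M'; lra.
  by move=> /(inner_sub d0'); apply: heta; exact: le_lt_trans wzs _.
have Uzs : U zs by apply: DU; apply: square_center; exact: ltW.
have back s z : (forall c', c' \in s -> nm (c' - c) <= r) -> U (orb s z) ->
    U z /\ forall q, q \in bwd e s z ->
      [/\ q.1.1 != 0, ~ U q.2 & forall x, U (quad_eval q x) -> U x].
  elim: s z => [//|a s IH] z sr /= Uo.
  have ar : nm (a - c) <= r by apply: sr; rewrite mem_head.
  have [|Uf hs] := IH (z ^+ 2 + a) _ Uo.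
    by move=> c' c's; apply: sr; rewrite inE c's orbT.
  have [zM nKz] := step _ _ ar Uf.
  split; first by split; [lra|move=> /(inner_sub d0')].
  move=> q; rewrite inE => /orP[/eqP ->|/hs //]; split => /=.
  - by rewrite invr_eq0 expf_neq0 // rc1D_neq0.
  - by move=> [_]; apply; have := Kin a 0 ar K0; rewrite expr0n add0r.
  move=> x; rewrite bwd_evalE // => /(step _ _ ar).
  set y := _ / _ => -[yM nKy].
  have xy : x = y + rc e * (y - z).
    rewrite /y; have := rc1D_neq0 e0'; rewrite rcD rc1 => ?; by field.
  have nxy : nm (rc e * (y - z)) <= d1.
    rewrite nmM nm_rc ger0_norm // -eM ler_wpM2l //.
    by have := nmD y (- z); rewrite nmN; lra.
  split; first by rewrite xy; have := nmD y (rc e * (y - z)); lra.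
  move=> xin; apply: nKy.
  have -> : y = x + - (rc e * (y - z)) by rewrite {1}xy addrK.
  by apply: xin; rewrite nmN; exact: le_trans nxy d1d.
exists e => //; exists (rho / (2 * M')); first by rewrite divr_gt0 // mulr_gt0.
move=> s sr szs; rewrite (chain_deriv_bwd s zs e0') nmM nmX nm_rc.
rewrite ger0_norm ?addr_ge0 // mulf_eq0 negb_or => /andP[_ m0].
rewrite mulrC ler_wpM2l ?exprn_ge0 ?addr_ge0 //.
have [|_ hs] := back s zs sr; first by rewrite szs.
apply: (chain_deriv_lower (U := U) (w0 := zs)) => //; first by move=> w [].
by rewrite chain_bwd.
Qed.

Lemma no_bounded_inside K c r d M ct s z : 0 < d -> 0 < M -> 0 <= r ->
  maps_inside K c r d -> (forall x, K x -> nm x <= M) -> K !=set0 -> nm_closed K ->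
  nm (ct - c) <= r -> superattracting ct ->
  (0 < size s)%N -> (forall c', c' \in s -> nm (c' - c) <= r) ->
  parabolic_periodic_point (fpoly_comp s) z -> False.
Proof.
move=> d0 M0 r0 Kin KM Kn Kcl ctr sct s0 sr parz; have d0' := ltW d0.
have K0 := zero_in d0 M0 Kin KM Kn Kcl ctr sct.
have words := parabolic_words s0 parz.
have [Kz|nKz] := pselect (K z).
  have [e e0 [B hB]] := mult_upper d0 M0 Kin KM.
  have [n hn] := expn_unbounded B e0.
  have [t [ts nt t0 tz mt]] := words n.
  have tr c' : c' \in t -> nm (c' - c) <= r by move=> /ts; exact: sr.
  (* The periodic point is its own image under a non-empty word. *)
  have zin : inner K d z by rewrite -tz; exact: (orb_inner d0' Kin).
  by have := hB t z tr zin; rewrite mt nm1 mul1r leNgt hn.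
have [e e0 [B B0 hB]] := mult_lower d0 M0 r0 Kin KM Kcl K0 nKz.
have [n hn] := expn_unbounded B^-1 e0.
have [t [ts nt t0 tz mt]] := words n.
have tr c' : c' \in t -> nm (c' - c) <= r by move=> /ts; exact: sr.
have := hB t tr tz; rewrite mt nm1 oner_neq0 => /(_ isT).
by rewrite -ler_pdivlMl // mulr1 leNgt hn.
Qed.

(** * From compact sets of the sphere to bounded closed sets of the plane *)

Lemma nbhs_nm w (eta : R) : 0 < eta -> nbhs w [set y : C | nm (y - w) < eta].
Proof.
move=> eta0; apply/nbhs_ballP; exists (rc eta); first by rewrite /= -rc0 rc_lt.
by move=> y; rewrite /ball /= norm_nm rc_lt nmB.
Qed.

(** Near each finite point the discs of radius [n] eventually cover; compactness makes [n] uniform.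
    The value of [P] at infinity is immaterial, since [L] omits it. *)
Lemma planar_compact_bounded (L : set (Chat R)) : compact L -> planar L ->
  exists2 M : R, 0 < M & forall w, L (Some w) -> nm w <= M.
Proof.
move=> /compact_near_coveringP cL pL.
pose P (n : nat) (x : Chat R) : bool := if x is Some w then nm w <= n%:R else true.
have : \forall n \near \oo, L `<=` P n.
  apply: cL => -[w|//] Lw.
  exists ([set x : Chat R | if x is Some y then nm (y - w) < 1 else false],
          [set n : nat | nm w + 1 <= n%:R]).
    split => /=; last exact: nbhs_infty_ger.
    exact: (nbhs_nm w ltr01).
  move=> [[y|] n] [] //= yw wn.
  by have := nmD (y - w) w; rewrite subrK; lra.
move=> [n _ /(_ n (leqnn n)) h]; exists n.+1%:R; first by rewrite ltr0n.
by move=> w /h /= wn; apply: le_trans wn _; rewrite ler_nat.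
Qed.

Lemma planar_compact_nm_closed (L : set (Chat R)) : compact L -> planar L ->
  nm_closed [set w | L (Some w)].
Proof.
move=> /compact_near_coveringP cL pL w nLw.
pose P (n : nat) (x : Chat R) : bool :=
  if x is Some y then n.+1%:R^-1 <= nm (y - w) else true.
have : \forall n \near \oo, L `<=` P n.
  apply: cL => -[y|//] Ly.
  have yw : 0 < nm (y - w).
    by rewrite nm_gt0 subr_eq0; apply: contra_notN nLw => /eqP <-.
  have yw2 : 0 < nm (y - w) / 2 by lra.
  exists ([set x : Chat R | if x is Some v then nm (v - y) < nm (y - w) / 2 else false],
          [set n : nat | n.+1%:R^-1 < nm (y - w) / 2]).
    split => /=; last exact: near_inv_lt.
    exact: (nbhs_nm y yw2).
  move=> [[v|] n] [] //=; set k := n.+1%:R^-1 => vy kn.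
  by have := nmD_ge (y - w) (v - y); rewrite [y - w + _]addrC addrA subrK; lra.
move=> [n _ /(_ n (leqnn n)) h]; exists n.+1%:R^-1; first by rewrite invr_gt0.
by move=> y yw Ly; have := h _ Ly; rewrite /P /= leNgt yw.
Qed.

Lemma cball_nm c (r : R) c' : cball c r c' <-> nm (c' - c) <= r.
Proof. by rewrite /cball /= norm_nm -rc_le. Qed.

End semigroup.

Theorem theorem4p19 (R : realType) (c : Cx R) (r0 : R) :
  0 <= r0 ->
  (exists ct : Cx R, cball c r0 ct /\ superattracting ct) ->
  (exists cs : seq (Cx R),
      (0 < size cs)%N /\ (forall c', c' \in cs -> cball c r0 c') /\
      exists z : Cx R, parabolic_periodic_point (fpoly_comp cs) z) ->
  (r_bif c <= r0%:E)%E.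
Proof.
move=> r00 [ct [/cball_nm ctr sct]] [cs [cs0 [csr [z parz]]]].
apply: ge_ereal_sup => _ [r [r_ge0 [L [[[[x Lx] [cL Linv]] _] pL]]] <-].
rewrite lee_fin leNgt; apply/negP => r0r.
have [M M0 LM] := planar_compact_bounded cL pL.
apply: (@no_bounded_inside R [set w | L (Some w)] c r0 (r - r0) M ct cs z) => //.
- by rewrite subr_gt0.
- move=> c' w c'r Lw u ur /=.
  (* A translation by [u] after [f_c'] is the map with parameter [c' + u], which lies within
     [r0 + (r - r0) = r] of [c]. *)
  apply: (Linv (fhat_comp [:: c' + u])).
    exists [:: c' + u]; split => //; split => // a; rewrite inE => /eqP ->.
    apply/cball_nm; rewrite addrAC.
    by have := nmD (c' - c) u; lra.
  by exists (Some w) => //; congr Some; exact: addrA.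
- by case: x Lx => [w Lw|//]; exists w.
- exact: planar_compact_nm_closed.
- by move=> c' /csr /cball_nm.
Qed.
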